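(* Let $\alpha\in(0,1)$ and let $\{T_n\}_{n\ge1}$ be the $\alpha$-sublinear preferential attachment tree sequence, with first vertex $v_1$. For every $\epsilon>0$ there exists a constant $K$ (depending on $\epsilon$) such that $$\liminf_{n\to\infty}\mathbb P\left(v_1\in H^K_\psi(T_n)\right)\ge 1-\epsilon.$$
   Context: $\alpha$-sublinear preferential attachment tree: the random tree sequence with attraction function $f(i)=(i+1)^\alpha$, $0<\alpha<1$, generated as follows. At time $n=1$, $T_1$ consists of a single vertex $v_1$. At time $n+1$, a new vertex $v_{n+1}$ is added to $T_n$ via a directed edge from a vertex $v_i$ to $v_{n+1}$, where $v_i\in\{v_1,\dots,v_n\}$ is chosen (conditionally on the past) with probability proportional to $f(\text{Out-Deg}(v_i))$, and $\text{Out-Deg}(v_i)$ is the number of children of $v_i$ in $T_n$. For a tree $T$ (edge directions ignored) and vertices $u\ne v$, $(T,u)_{v\downarrow}$ is the subtree consisting of $v$ and all its descendants when $T$ is rooted at $u$; $|\cdot|$ is the number of vertices. Define $\psi_T(u)=\max_{v\in V(T)\setminus\{u\}}|(T,u)_{v\downarrow}|$. $H^K_\psi(T_n)$ denotes the set of the $K$ vertices of $T_n$ with the smallest values of $\psi_{T_n}$ (ties broken arbitrarily; $n\ge K$). *)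

(* Defs.v *)
From HB Require Import structures.
From mathcomp Require Import all_boot all_order all_algebra.
From mathcomp Require Import all_classical all_reals all_analysis.

Set Implicit Arguments.
Unset Strict Implicit.
Unset Printing Implicit Defensive.

Import Order.TTheory GRing.Theory Num.Theory.

Local Open Scope ring_scope.
Local Open Scope classical_set_scope.

(* A tree is given by its adjacency relation [e] on its vertex set [V].
   [v] is an ancestor of [w] (or [w] itself) in the tree rooted at [u] when
   [v] lies on the simple path from [u] to [w]. *)
Definition subtree (V : finType) (e : rel V) (u v : V) : {set V} :=
  [set w | `[< exists p : seq V,
      [/\ path e u p, uniq (u :: p), last u p = w & v \in u :: p] >]]%SET.

Definition psi (V : finType) (e : rel V) (u : V) : nat :=
  (\max_(v | v != u) #|subtree e u v|)%N.

(* [A] consists of [K] points with the smallest values of [g], for some way of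
   breaking the ties. *)
Definition least_values (V : finType) (g : V -> nat) (K : nat) (A : {set V}) :
    Prop :=
  #|A| = K /\ forall u v, u \in A -> v \notin A -> (g u <= g v)%N.

(* A growing sequence of trees on the vertices 0, 1, 2, ...: vertex 0 is the
   first one, and [a k] is the vertex, among 0, ..., k, to which vertex
   [k.+1] is attached.  The [n]-th tree, on the vertex set ['I_n.+1], is thus
   the one reached after [n] steps; it has [n.+1] vertices. *)
Definition growth := forall k : nat, 'I_k.+1.

Definition child (a : growth) (n : nat) : rel 'I_n.+1 :=
  fun i j => if val j is k.+1 then val (a k) == val i else false.

Definition adj (a : growth) (n : nat) : rel 'I_n.+1 :=
  fun i j => child a i j || child a j i.
Arguments adj : clear implicits.

Definition outdeg (a : growth) (n : nat) (i : 'I_n.+1) : nat :=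
  #|[set j | child a i j]%SET|.

Definition attraction (R : realType) (alpha : R) (i : nat) : R :=
  i.+1%:R `^ alpha.

Definition past (T : Type) (X : T -> growth) (a : growth) (n : nat) : set T :=
  [set w | forall k, (k < n)%N -> X w k = a k].

(* The conditional law of the [n]-th attachment, given that the first [n]
   ones agree with [a], in the product form P(A `&` B) = P(A) * P(B | A), which
   is void when P(A) = 0. *)
Definition preferential_attachment (R : realType) (alpha : R)
    (d : measure_display) (T : measurableType d) (P : probability T R)
    (X : T -> growth) : Prop :=
  (forall n (i : 'I_n.+1), measurable [set w | X w n = i]) /\
  (forall (a : growth) n (i : 'I_n.+1),
    P (past X a n `&` [set w | X w n = i]) =
    (P (past X a n) *
     (attraction alpha (outdeg a i) /
      \sum_(j < n.+1) attraction alpha (outdeg a j))%:E)%E).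

(* Main.v *)
(* Give a vertex with k children the weight g k, where g solves
   f k * (g (k + 1) - g k + g 0) = l * g k, as for the reproductive value in a
   branching process. When a vertex is attached, the mean increment of the total
   weight of any subtree is then l / (total attraction) times this weight, with
   the same factor for all the subtrees; since the increments are bounded, the
   share of a subtree in the total weight is a martingale up to a relative error
   O(1/n^2). The share of the subtree below vertex m is O(1/m) at its birth, and
   its second moment stays O(1/m^2): summing over m >= K, no vertex from K on
   ever gets a sizeable share, up to a small probability. On the other hand, for
   a fixed vertex c the logarithm of the share of the complement of the subtree
   below c has a mean value which stays bounded below, so that this share does
   not become small.
   If the root is not among the K best vertices, then some m >= K has
   psi m <= psi 0. With c the vertex at which psi 0 is attained, the complement
   of the subtree below c is not larger than the subtree below m, which is
   unlikely by the above, as the weight of a subtree is comparable to its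
   size. *)

Require Import Defs.
From HB Require Import structures.
From mathcomp Require Import all_boot all_order all_algebra.
From mathcomp Require Import all_classical all_reals all_analysis.
From mathcomp Require Import ring lra zify.

Set Implicit Arguments.
Unset Strict Implicit.
Unset Printing Implicit Defensive.

Import Order.TTheory GRing.Theory Num.Theory.
Import numFieldNormedType.Exports.

Local Open Scope ring_scope.
Local Open Scope classical_set_scope.

(** * The weight function *)

Lemma attraction_ge1 (R : realType) (alpha : R) k :
  0 <= alpha -> 1 <= attraction alpha k.
Proof.
move=> a0; rewrite /attraction; have e1 : 1 `^ alpha = 1 :> R by rewrite powR1.
rewrite -[leLHS]e1.
by apply: (ge0_ler_powR a0); rewrite ?nnegrE ?ler0n ?ler1n.
Qed.

Lemma attraction_le (R : realType) (alpha : R) k :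
  alpha <= 1 -> attraction alpha k <= k.+1%:R.
Proof. by move=> a1; rewrite /attraction ler1_powR// ler1n. Qed.

(** Young's inequality with exponents [1 / alpha] and [1 / (1 - alpha)] gives
    [u * w <= k + 1 + alpha] for [u = (k + 2) ^ alpha] and [w = (k + 1) ^ (1 - alpha)]; it remains
    to divide by [w >= 1]. *)
Lemma attractionS_le (R : realType) (alpha : R) k :
  0 < alpha < 1 -> attraction alpha k.+1 <= attraction alpha k + alpha.
Proof.
move=> /andP[a0 a1]; have b0 : 0 < 1 - alpha by rewrite subr_gt0.
have /(_ _ _ _ _)/= := @conjugate_powR R (attraction alpha k.+1)
  (k.+1%:R `^ (1 - alpha)) alpha^-1 (1 - alpha)^-1.
rewrite /attraction !powR_ge0 !invr_gt0 !invrK a0 b0 -!powRrM.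
rewrite !mulfV ?gt_eqF// !powRr1//.
have aE : alpha + (1 - alpha) = 1 by ring.
rewrite aE; move=> /(_ erefl erefl erefl erefl erefl).
set u := k.+2%:R `^ _; set v := k.+1%:R `^ alpha; set w := k.+1%:R `^ _ => h.
have k1 : 1 <= k.+1%:R :> R by rewrite ler1n.
have vw : v * w = k.+1%:R.
  rewrite /v /w -powRD; last by rewrite pnatr_eq0 implybT.
  by rewrite aE powRr1.
have w1 : 1 <= w.
  have e1 : 1 `^ (1 - alpha) = 1 :> R by rewrite powR1.
  rewrite -[leLHS]e1.
  by apply: (ge0_ler_powR (ltW b0)); rewrite ?nnegrE ?ler0n ?ler01.
have w0 : 0 < w by apply: lt_le_trans w1.
rewrite -(ler_pM2r w0); apply: (le_trans h).
have -> : (v + alpha) * w = k.+1%:R + alpha * w by rewrite mulrDl vw.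
by rewrite -(natr1 k.+1); nra.
Qed.

Section Eigenfunction.
Variables (R : realType) (f : nat -> R) (q : R).
Hypotheses (q0 : 0 <= q) (q1 : q < 1) (f_ge1 : forall k, 1 <= f k)
  (f_le : forall k, f k <= k.+1%:R) (fS_le : forall k, f k.+1 <= f k + q).

(** The equation for the weight, solved forward from 1 for any [l]. Divided by the product of the
    [1 + l / f i], [i < k], the solution is 1 minus a partial sum of products of the
    [f i / (f i + l)]. It stays nonnegative when the whole series is at most 1: the least such [l]
    is the Malthusian parameter. *)
Fixpoint eigen (l : R) (k : nat) : R :=
  if k is k'.+1 then eigen l k' * (1 + l / f k') - 1 else 1.

Let f_gt0 k : 0 < f k. Proof. exact: lt_le_trans (f_ge1 k). Qed.

Lemma eigenS l k : f k * (eigen l k.+1 - eigen l k + 1) = l * eigen l k.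
Proof. by rewrite /=; have := f_gt0 k; move=> /lt0r_neq0 ?; field. Qed.

Lemma continuous_eigen k : continuous (eigen^~ k).
Proof.
elim: k => [|k IHk] l; first exact: cst_continuous.
apply: cvgB; last exact: cvg_cst.
apply: cvgM; first exact: IHk.
by apply: cvgD; [exact: cvg_cst|apply: cvgM => //; exact: cvg_cst].
Qed.

Let E := [set l : R | 1 <= l /\ forall k, 0 <= eigen l k].

(** For [l = 2], a value at least [k + 1 >= f k] is followed by one larger by at least [2 - 1]. *)
Lemma eigen2_ge k : k.+1%:R <= eigen 2 k.
Proof.
elim: k => [|k IHk] //=; have fk := f_gt0 k; have fk' := f_le k.
have : 2 <= eigen 2 k * (2 / f k).
  rewrite mulrA ler_pdivlMr//; nra.
by rewrite -(natr1 k.+1) mulrDr mulr1; lra.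
Qed.

Let E2 : E 2.
Proof. by split=> [|k]; rewrite ?ler1n// (le_trans _ (eigen2_ge k)). Qed.

Let lbE : has_lbound E. Proof. by exists 1 => l []. Qed.

(** By continuity in [l], a negative value at the infimum would remain negative at members of [E]
    close to it. *)
Let infE : E (inf E).
Proof.
have supE : has_inf E by split=> //; exists 2; exact: E2.
split; first by apply: lb_le_inf => [|l []//]; exists 2; exact: E2.
move=> k; rewrite leNgt; apply/negP => lt0.
have : \forall m \near inf E, eigen m k < 0.
  exact: (cvgr_lt _ (@continuous_eigen k (inf E))).
move=> /nbhs_ballP[e /= e0 he].
have [m Em me] := inf_adherent e0 supE.
have : ball (inf E) e m.
  by rewrite /ball/= ltr_distlC; have := ge_inf lbE Em; lra.
by move=> /he; rewrite ltNge; case: Em => _ ->.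
Qed.

(* Minimality of [l]: an [eigen l k] above the threshold would make all the
   later values positive, for slightly smaller [l] as well. *)
Lemma eigen_inf_le k : eigen (inf E) k <= (1 - q)^-1 * f k.
Proof.
set l := inf E; set C := (1 - q)^-1; have [l1 l_ge0] := infE.
have C1 : C * (1 - q) = 1 by rewrite mulVf// gt_eqF// subr_gt0.
have C_gt0 : 0 < C by rewrite invr_gt0 subr_gt0.
clearbody C.
have C_ge1 : 1 <= C.
  by have := mulr_ge0 (ltW C_gt0) q0; move: C1; rewrite mulrBr mulr1; lra.
rewrite -/l in l1 l_ge0 *.
(* A zero value would be followed by [-1]. *)
have l_gt0 j : 0 < eigen l j.
  have := l_ge0 j.+1; rewrite /= lt_neqAle l_ge0 andbT.
  by apply: contraTneq => <-; rewrite mul0r sub0r -ltNge oppr_lt0.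
(* Above [C * f], one step adds at least [C - 1 = C * q], which is the most that [C * f] can gain:
   the values stay above. *)
have grow m j : 1 <= m -> C * f k <= eigen m k ->
    C * f (k + j) <= eigen m (k + j).
  move=> m1 Ck; elim: j => [|j]; rewrite ?addn0// addnS /=.
  set i := (k + j)%N => IHj; have fi := f_gt0 i; have fSi := fS_le i.
  have : C <= eigen m i * (m / f i).
    rewrite mulrA ler_pdivlMr//; apply: (le_trans IHj).
    by rewrite ler_peMr// (le_trans _ IHj)// mulr_ge0// ltW.
  have := ler_wpM2l (ltW C_gt0) fSi; rewrite !mulrDr mulr1.
  by move: C1; rewrite mulrBr mulr1; lra.
rewrite leNgt; apply/negP => lt_k.
(* At [l = 1] the values never exceed 1, hence not the threshold either; so [l] can be lowered a
   little while remaining above 1. *)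
have l1' : 1 < l.
  rewrite lt_neqAle l1 andbT; apply/eqP => l1E.
  suff le1 : eigen l k <= 1.
    by move: lt_k; rewrite ltNge (le_trans le1)// mulr_ege1.
  rewrite -l1E; elim: (k) => //= j IHj.
  have : eigen 1 j * (1 / f j) <= 1.
    by rewrite mulrA mulr1 ler_pdivrMr// mul1r (le_trans IHj).
  by rewrite mulrDr mulr1; lra.
have near_pos j : \forall m \near l, forall i, (i < j)%N -> 0 < eigen m i.
  elim: j => [|j IHj]; first by near=> m.
  have hj : \forall m \near l, 0 < eigen m j.
    by apply: (cvgr_gt _ (@continuous_eigen j l)); exact: l_gt0.
  near=> m => i; rewrite ltnS leq_eqVlt => /predU1P[->|]; first by near: m.
  by move: i; near: m.
have h1 : \forall m \near l, 1 < m by exact: lt_nbhsr.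
have h2 : \forall m \near l, C * f k < eigen m k.
  exact: (cvgr_gt _ (@continuous_eigen k l)).
have : \forall m \near l, (1 < m /\ C * f k < eigen m k) /\
    forall i, (i < k)%N -> 0 < eigen m i.
  by apply: filterI; [exact: filterI|exact: near_pos].
move=> /nbhs_ballP[e /= e0 he].
have le : l - e / 2 < l by rewrite ltrBlDr ltrDl divr_gt0.
have /he[[m1 Ck] pos_m] : ball l e (l - e / 2).
  by rewrite /ball/= opprB addrC subrK gtr0_norm ?divr_gt0//; lra.
suff /(ge_inf lbE) : E (l - e / 2) by rewrite leNgt le.
split=> [|j]; first exact: ltW.
have [jk|kj] := ltnP j k; first by apply: ltW; exact: pos_m.
rewrite -(subnKC kj); apply: le_trans (grow _ _ (ltW m1) (ltW Ck)).
by rewrite mulr_ge0// ltW// (lt_le_trans _ C_ge1).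
Unshelve. all: by end_near. Qed.

Lemma exists_eigenfunction : exists (l : R) (g : nat -> R) (c C : R),
  [/\ [/\ 0 < l, 0 < c & 0 < C], g 0%N = 1,
    forall k, f k * (g k.+1 - g k + 1) = l * g k,
    forall k, c <= g k & forall k, g k <= C * f k].
Proof.
have [l1 l_ge0] := infE; set l := inf E in l1 l_ge0 *.
have l0 : 0 < l by apply: lt_le_trans l1.
exists l, (eigen l), (1 + l)^-1, (1 - q)^-1; split=> //.
- split=> //; first by rewrite invr_gt0 addr_gt0.
  by rewrite invr_gt0 subr_gt0.
- by move=> k; rewrite eigenS.
(* Nonnegativity of the next value reads [1 <= g k * (1 + l / f k)], and [f k >= 1]. *)
- move=> k; have := l_ge0 k.+1; have f1 := f_ge1 k; have fk := f_gt0 k.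
  rewrite /= subr_ge0 => h.
  rewrite -[leLHS]mul1r ler_pdivrMr ?addr_gt0//; apply: (le_trans h).
  have g0 := l_ge0 k; rewrite ler_wpM2l// lerD2l ler_pdivrMr//; nra.
- exact: eigen_inf_le.
Qed.

End Eigenfunction.

(** * One step of a share *)

Lemma eqW (R : realType) (a b : R) : a = b -> a <= b.
Proof. by move->. Qed.

(* [x] and [y] grow by the random amounts [u] and [v], of which the mean values
   are proportional to [x] and [y] with the same factor [r]: to first order,
   [x / y] is then a martingale. *)
Section OneStep.
Variables (R : realType) (I : finType) (p u v : I -> R) (x y r B : R).
Hypotheses (p_ge0 : forall i, 0 <= p i) (sum_p : \sum_i p i = 1).
Hypotheses (mean_u : \sum_i p i * u i = r * x)
  (mean_v : \sum_i p i * v i = r * y).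
Hypotheses (u_ge0 : forall i, 0 <= u i) (u_le : forall i, u i <= B).
Hypotheses (v_ge0 : forall i, 0 <= v i) (v_le : forall i, v i <= B).
Hypotheses (x_ge0 : 0 <= x) (y_gt0 : 0 < y).

(** Only the means of [u] and [v] are known, so each estimate below starts from a pointwise bound
    which is affine in them. *)
Lemma mean_le_affine (F : I -> R) a b c :
  (forall i, F i <= a + b * u i + c * v i) ->
  \sum_i p i * F i <= a + b * (r * x) + c * (r * y).
Proof.
move=> F_le; rewrite -mean_u -mean_v !mulr_sumr -[X in X + _ + _]mulr1 -sum_p.
rewrite mulr_sumr -!big_split/=; apply: ler_sum => i _.
by apply: le_trans (ler_wpM2l (p_ge0 i) (F_le i)) _; apply: eqW; ring.
Qed.

Let vy i : 0 < y + v i. Proof. by rewrite ltr_pwDl. Qed.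

Let iy_ge0 n : 0 <= y^-1 ^+ n.
Proof. by rewrite exprn_ge0// invr_ge0 ltW. Qed.

Let inv_le i : (y + v i)^-1 <= y^-1 - v i * y^-1 ^+ 2 + B ^+ 2 * y^-1 ^+ 3.
Proof.
apply: (@le_trans _ _ (y^-1 - v i * y^-1 ^+ 2 + v i ^+ 2 * y^-1 ^+ 3)).
  rewrite -subr_ge0; have -> : y^-1 - v i * y^-1 ^+ 2 + v i ^+ 2 * y^-1 ^+ 3 -
      (y + v i)^-1 = v i ^+ 3 * y^-1 ^+ 3 * (y + v i)^-1.
    have := lt0r_neq0 (vy i); have := lt0r_neq0 y_gt0 => ? ?.
    by field; apply/andP.
  by rewrite !mulr_ge0 ?exprn_ge0 ?invr_ge0// ltW.
rewrite lerD2l ler_wpM2r ?iy_ge0// lerXn2r ?nnegrE//.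
exact: le_trans (v_ge0 i) (v_le i).
Qed.

Let inv2_le i : (y + v i)^-1 ^+ 2 <=
  y^-1 ^+ 2 - (2 * v i) * y^-1 ^+ 3 + 3 * B ^+ 2 * y^-1 ^+ 4.
Proof.
apply: (@le_trans _ _
    (y^-1 ^+ 2 - (2 * v i) * y^-1 ^+ 3 + 3 * v i ^+ 2 * y^-1 ^+ 4)).
  rewrite -subr_ge0.
  have -> : y^-1 ^+ 2 - (2 * v i) * y^-1 ^+ 3 + 3 * v i ^+ 2 * y^-1 ^+ 4 -
      (y + v i)^-1 ^+ 2 =
      v i ^+ 3 * (4 * y + 3 * v i) * y^-1 ^+ 4 * (y + v i)^-1 ^+ 2.
    have := lt0r_neq0 (vy i); have := lt0r_neq0 y_gt0 => ? ?.
    by field; apply/andP.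
  by rewrite !mulr_ge0 ?exprn_ge0 ?invr_ge0 ?addr_ge0 ?mulr_ge0 ?(ltW (vy i))
    ?(ltW y_gt0).
rewrite lerD2l ler_wpM2r ?iy_ge0// ler_wpM2l// lerXn2r ?nnegrE//.
exact: le_trans (v_ge0 i) (v_le i).
Qed.

(** The first-order terms [r * x / y] cancel; only the second-order term of [inv_le] is left. *)
Lemma mean_ratio : \sum_i p i * ((x + u i) / (y + v i)) <=
  x / y * (1 + B ^+ 2 / y ^+ 2).
Proof.
apply: (@le_trans _ _ (x * (y^-1 + B ^+ 2 * y^-1 ^+ 3) + y^-1 * (r * x) +
    (- x * y^-1 ^+ 2) * (r * y))).
  apply: mean_le_affine => i; rewrite mulrDl.
  have h1 := ler_wpM2l x_ge0 (inv_le i).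
  have h2 : u i / (y + v i) <= u i / y.
    by rewrite ler_wpM2l// lef_pV2 ?posrE// lerDl.
  apply: le_trans (lerD h1 h2) _; by apply: eqW; ring.
apply: eqW.
by have := lt0r_neq0 y_gt0 => ?; field.
Qed.

(** The bound [u ^ 2 <= B * u] makes the square affine in [u]. The first-order terms cancel again,
    and this bound is the source of the extra term, linear in [x]. *)
Lemma mean_ratio2 : \sum_i p i * ((x + u i) / (y + v i)) ^+ 2 <=
  (x / y) ^+ 2 * (1 + 3 * B ^+ 2 / y ^+ 2) + B * r * x / y ^+ 2.
Proof.
apply: (@le_trans _ _ (x ^+ 2 * (y^-1 ^+ 2 + 3 * B ^+ 2 * y^-1 ^+ 4) +
    ((2 * x + B) * y^-1 ^+ 2) * (r * x) +
    (- x ^+ 2 * 2 * y^-1 ^+ 3) * (r * y))).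
  apply: mean_le_affine => i.
  have h1 := ler_wpM2l (sqr_ge0 x) (inv2_le i).
  have h2 : (2 * x * u i + u i ^+ 2) * (y + v i)^-1 ^+ 2 <=
      ((2 * x + B) * u i) * y^-1 ^+ 2.
    apply: ler_pM; rewrite ?exprn_ge0 ?invr_ge0 ?(ltW (vy i))//.
    - by rewrite addr_ge0 ?mulr_ge0.
    - by rewrite [leRHS]mulrDl lerD2l expr2 ler_wpM2r.
    - rewrite lerXn2r ?nnegrE ?invr_ge0 ?(ltW (vy i)) ?(ltW y_gt0)//.
      by rewrite lef_pV2 ?posrE// lerDl.
  have -> : ((x + u i) / (y + v i)) ^+ 2 = x ^+ 2 * (y + v i)^-1 ^+ 2 +
    (2 * x * u i + u i ^+ 2) * (y + v i)^-1 ^+ 2 by ring.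
  apply: le_trans (lerD h1 h2) _; by apply: eqW; ring.
apply: eqW.
by have := lt0r_neq0 y_gt0 => ?; field.
Qed.

(** The logarithms contribute at most [v / y - u / (x + u)], whereas [v / y - u / x] has mean zero.
    As [u <= B], the decrease of [B / x] pays for the difference. *)
Lemma mean_log_ratio : 0 < x ->
  \sum_i p i * (ln (y + v i) - ln (x + u i) + B / (x + u i)) <=
  ln y - ln x + B / x.
Proof.
move=> x_gt0.
apply: (@le_trans _ _ (ln y - ln x + B / x + (- x^-1) * (r * x) +
    y^-1 * (r * y))); last first.
  apply: eqW; have := lt0r_neq0 y_gt0; have := lt0r_neq0 x_gt0 => ? ?.
  by field; apply/andP.
have ln_le (a b : R) : 0 < a -> 0 < b -> ln b - ln a <= b / a - 1.
  move=> a0 b0; rewrite -ln_div ?posrE//.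
  by rewrite -[X in ln X](subrK 1) addrC le_ln1Dx// ltrBrDl subrr divr_gt0.
apply: mean_le_affine => i.
have xu : 0 < x + u i by rewrite ltr_pwDl.
have h1 : ln (y + v i) - ln y <= v i / y.
  apply: le_trans (ln_le _ _ y_gt0 (vy i)) _.
  by rewrite mulrDl divff ?gt_eqF// addrC addKr.
have h2 : ln x - ln (x + u i) <= - (u i / (x + u i)).
  apply: le_trans (ln_le _ _ xu x_gt0) _; apply: eqW.
  by have := lt0r_neq0 xu => ?; field.
have h3 : (B - u i) / (x + u i) <= (B - u i) / x.
  by rewrite ler_wpM2l ?subr_ge0// lef_pV2 ?posrE// lerDl.
move: h3; rewrite !mulrBl [- x^-1 * _]mulNr [x^-1 * _]mulrC [y^-1 * _]mulrC.
by lra.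
Qed.

End OneStep.

(** * The growth process *)

Section Process.
Variables (R : realType) (f : nat -> R).
Hypothesis f_ge1 : forall k, 1 <= f k.

Definition agree n (a b : growth) := forall k, (k < n)%N -> a k = b k.

(** The type of [a k] depends on [k], hence [inord], which at [k = n] preserves the value of [i]. *)
Definition upd (a : growth) n (i : 'I_n.+1) : growth :=
  fun k => if k == n then inord i else a k.

Definition deg (a : growth) n (v : nat) : nat :=
  (\sum_(k < n) (a k == v :> nat))%N.

Definition mass (phi : nat -> R) (s : pred nat) (a : growth) n : R :=
  \sum_(v < n.+1 | s v) phi (deg a n v).

Definition jump (a : growth) n (i : 'I_n.+1) : R :=
  f (deg a n i) / mass f predT a n.

Definition step n (F : growth -> R) (a : growth) : R :=
  \sum_(i < n.+1) jump a i * F (upd a i).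

(* [steps j k F a] is the mean value of [F] once [k] vertices have been added
   to the [j]-th tree of [a]. *)
Fixpoint steps j k (F : growth -> R) : growth -> R :=
  if k is k'.+1 then step j (steps j.+1 k' F) else F.

Lemma upd_agree a n (i : 'I_n.+1) : agree n (upd a i) a.
Proof. by move=> k kn; rewrite /upd ltn_eqF. Qed.

Lemma upd_at a n (i : 'I_n.+1) : upd a i n = i.
Proof. by apply: val_inj; rewrite /upd eqxx/= inordK. Qed.

Lemma deg_upd a n (i : 'I_n.+1) v :
  deg (upd a i) n.+1 v = (deg a n v + (i == v :> nat))%N.
Proof.
rewrite /deg big_ord_recr/= upd_at; congr addn.
by apply: eq_bigr => k _; rewrite upd_agree.
Qed.

Lemma deg_gt a n v : (n <= v)%N -> deg a n v = 0%N.
Proof.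
move=> nv; apply: big1 => k _; apply/eqP; rewrite eqb0 ltn_eqF//.
by rewrite (leq_trans (ltn_ord (a k)))// (leq_trans (ltn_ord k)).
Qed.

Lemma mass_ge c (phi : nat -> R) (s : pred nat) a n : (forall k, c <= phi k) ->
  c * \sum_(v < n.+1 | s v) 1 <= mass phi s a n.
Proof. by move=> c_le; rewrite mulr_sumr ler_sum// => v _; rewrite mulr1. Qed.

Lemma mass_predT_ge c (phi : nat -> R) a n : (forall k, c <= phi k) ->
  c * n.+1%:R <= mass phi predT a n.
Proof.
move=> /(mass_ge predT a n); rewrite sumr_const.
by rewrite (_ : #|_| = n.+1)// -[RHS]card_ord.
Qed.

Lemma mass_gt0 a n : 0 < mass f predT a n.
Proof.
apply: lt_le_trans (mass_predT_ge a n f_ge1).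
by rewrite mul1r ltr0n.
Qed.

Lemma jump_ge0 a n (i : 'I_n.+1) : 0 <= jump a i.
Proof.
by apply: divr_ge0; [exact: le_trans (f_ge1 _)|exact/ltW/mass_gt0].
Qed.

Lemma sum_jump a n : \sum_(i < n.+1) jump a i = 1.
Proof.
by rewrite -mulr_suml divff// gt_eqF// mass_gt0.
Qed.

Lemma steps_le j k F G a : (forall b, F b <= G b) ->
  steps j k F a <= steps j k G a.
Proof.
move=> FG; elim: k j a => [|k IHk] j a //=.
by apply: ler_sum => i _; rewrite ler_wpM2l ?jump_ge0.
Qed.

Lemma steps_cst j k c a : steps j k (fun=> c) a = c.
Proof.
elim: k j a => [|k IHk] j a //=.
rewrite /step; under eq_bigr do rewrite IHk.
by rewrite -mulr_suml sum_jump mul1r.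
Qed.

Lemma stepsB j k F G a :
  steps j k (fun b => F b - G b) a = steps j k F a - steps j k G a.
Proof.
elim: k j a => [|k IHk] j a //=.
by rewrite /step -sumrB; apply: eq_bigr => i _; rewrite IHk mulrBr.
Qed.

Lemma stepsD j k F G a :
  steps j k (fun b => F b + G b) a = steps j k F a + steps j k G a.
Proof.
elim: k j a => [|k IHk] j a //=.
by rewrite /step -big_split; apply: eq_bigr => i _; rewrite IHk mulrDr.
Qed.

Lemma stepsZ j k c F a : steps j k (fun b => c * F b) a = c * steps j k F a.
Proof.
elim: k j a => [|k IHk] j a //=.
by rewrite /step mulr_sumr; apply: eq_bigr => i _; rewrite IHk mulrCA.
Qed.

Lemma steps_sum (I : Type) (r : seq I) (p : pred I) j k
    (F : I -> growth -> R) a :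
  steps j k (fun b => \sum_(i <- r | p i) F i b) a =
  \sum_(i <- r | p i) steps j k (F i) a.
Proof.
elim: r => [|i r IHr].
  rewrite big_nil -[RHS](steps_cst j k 0 a); congr (steps _ _ _ _).
  by apply/funext => b; rewrite big_nil.
rewrite big_cons -IHr; case: ifPn => pi; rewrite -?stepsD;
  congr (steps _ _ _ _);
  by apply/funext => b; rewrite big_cons ?pi ?(negPf pi).
Qed.

Lemma steps_add j k l F a :
  steps j (k + l) F a = steps j k (steps (j + k) l F) a.
Proof.
elim: k j a => [|k IHk] j a; first by rewrite addn0.
by rewrite addSn /=; apply: eq_bigr => i _; rewrite IHk addSnnS.
Qed.

Lemma steps_supermartingale j k (M : nat -> growth -> R) a :
  (forall n b, (j <= n)%N -> step n (M n.+1) b <= M n b) ->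
  steps j k (M (j + k)%N) a <= M j a.
Proof.
elim: k j a => [|k IHk] j a hM /=; first by rewrite addn0.
apply: (@le_trans _ _ (step j (M j.+1) a)); last exact: hM.
apply: ler_sum => i _; rewrite ler_wpM2l ?jump_ge0//.
by rewrite -addSnnS; apply: IHk => n b jn; apply: hM; exact: ltnW.
Qed.

(** * The law of the process as iterated finite sums *)

Section Law.
Variables (d : measure_display) (T : measurableType d) (P : probability T R).
Variable X : T -> growth.
Hypothesis mX : forall n (i : 'I_n.+1), measurable [set w | X w n = i].
Hypothesis PX : forall (a : growth) n (i : 'I_n.+1),
  P (past X a n `&` [set w | X w n = i]) =
    (P (past X a n) * (jump a i)%:E)%E.

Let past_upd a n (i : 'I_n.+1) :
  past X (upd a i) n.+1 = past X a n `&` [set w | X w n = i].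
Proof.
apply/seteqP; split=> w /=; last move=> [hw Xi] k.
  move=> hw; split; last by rewrite hw ?upd_at.
  by move=> k kn; rewrite hw ?upd_agree// ltnW.
rewrite ltnS leq_eqVlt => /predU1P[->|kn]; first by rewrite Xi upd_at.
by rewrite hw ?upd_agree.
Qed.

Let measurable_past a n : measurable (past X a n).
Proof.
elim: n => [|n IHn].
  by rewrite (_ : past X a 0 = setT)//; apply/seteqP; split.
have -> : past X a n.+1 = past X a n `&` [set w | X w n = a n].
  apply/seteqP; split=> w /=; last move=> [hw Xi] k.
    by move=> hw; split=> [k kn|]; apply: hw => //; exact: ltnW.
  by rewrite ltnS leq_eqVlt => /predU1P[->//|/hw].
exact: measurableI.
Qed.

(** Induction on the number [k] of steps left: the event splits according to the [j]-th attachment,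
    and [PX] assembles the pieces into one [step]. Events decided by the first [n] attachments thus
    reduce to finite sums. *)
Lemma law_local (G : set growth) n :
    (forall a b, agree n a b -> G a -> G b) ->
  forall k j a, (j + k = n)%N ->
  measurable (past X a j `&` [set w | G (X w)]) /\
  P (past X a j `&` [set w | G (X w)]) =
    (P (past X a j) * (steps j k (fun b => `[< G b >]%:R) a)%:E)%E.
Proof.
move=> Gloc; elim=> [|k IHk] j a.
  rewrite addn0 => ->; have [Ga|NGa] := pselect (G a).
    have -> : past X a n `&` [set w | G (X w)] = past X a n.
      apply/setIidPl => w hw /=; apply: Gloc Ga => m mn; exact/esym/hw.
    by split=> //=; rewrite asboolT// mule1.
  have -> : past X a n `&` [set w | G (X w)] = set0.
    by apply/seteqP; split=> // w [hw /= /Gloc Gw]; apply: NGa; exact: Gw.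
  by split=> //=; rewrite asboolF// measure0 mule0.
rewrite -addSnnS => jk.
have -> : past X a j `&` [set w | G (X w)] =
    \big[setU/set0]_(i < j.+1) (past X (upd a i) j.+1 `&` [set w | G (X w)]).
  apply/seteqP; split=> [w [hw Gw]|w].
    rewrite (bigD1 (X w j))//=; left; split=> //.
    by rewrite past_upd.
  rewrite -bigcup_mkord_ord => -[i _]; rewrite past_upd.
  by move=> -[[hw _] Gw].
have IH (i : 'I_j.+1) := IHk j.+1 (upd a i) jk.
have mF := bigsetU_measurable (index_enum 'I_j.+1) (P := xpredT)
  (fun i _ => (IH i).1).
split=> //; rewrite measure_bigsetU_ord//=; last 2 first.
- by move=> i; exact: (IH i).1.
- apply/trivIsetP => i i' _ _ /eqP ii'; apply/seteqP; split=> // w.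
  rewrite !past_upd => -[[[_ /= Xi] _] [[_ /= Xi'] _]].
  by apply: ii'; rewrite -Xi.
under eq_bigr => i _ do rewrite (IH i).2 past_upd PX -muleA -EFinM.
rewrite -ge0_sume_distrr; last first.
  move=> i _; rewrite lee_fin mulr_ge0 ?jump_ge0//.
  by rewrite -[leLHS](steps_cst j.+1 k 0 (upd a i)) steps_le.
by rewrite sumEFin.
Qed.

(** Markov's inequality, with [F] dominating the indicator function of the complement of [G]. Any
    history [a] will do, since [past X a 0] is the whole space. *)
Lemma prob_ge_steps (G : set growth) n (F : growth -> R) a :
  (forall b c, agree n b c -> G b -> G c) ->
  (forall b, 0 <= F b) -> (forall b, ~ G b -> 1 <= F b) ->
  measurable [set w | G (X w)] /\
  ((1 - steps 0 n F a)%:E <= P [set w | G (X w)])%E.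
Proof.
move=> Gloc F_ge0 F_ge1; have [] := law_local Gloc a (add0n n).
have -> : past X a 0 = setT by apply/seteqP; split.
rewrite setTI probability_setT mul1e => mG ->; split=> //.
rewrite lee_fin -[X in X - _](steps_cst 0 n 1 a) -stepsB.
apply: steps_le => b; have [Gb|NGb] := pselect (G b).
  by rewrite asboolT//= gerBl.
by rewrite asboolF//= subr_le0 F_ge1.
Qed.

End Law.
End Process.

(** * Descendants *)

Fixpoint desc_rec (a : growth) (m t v : nat) : bool :=
  (v == m) || (if t is t'.+1 then
                 if v is k.+1 then desc_rec a m t' (a k) else false
               else false).

(* [v] is [m] or one of its descendants, the tree being rooted at 0; following
   the parents from [v] takes at most [v] steps. *)
Definition desc (a : growth) (m v : nat) := desc_rec a m v v.

Lemma desc_rec_eq a m t t' v : (v <= t)%N -> (v <= t')%N ->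
  desc_rec a m t v = desc_rec a m t' v.
Proof.
elim: t t' v => [|t IHt] [|t'] [|v] //= vt vt'.
congr orb; apply: IHt; apply: leq_trans (_ : v <= _)%N => //.
  by rewrite -ltnS.
by rewrite -ltnS.
Qed.

Lemma descS a m k : desc a m k.+1 = (k.+1 == m) || desc a m (a k).
Proof.
rewrite /desc /=; congr orb.
by apply: desc_rec_eq => //; rewrite -ltnS.
Qed.

Lemma desc_refl a m : desc a m m.
Proof. by rewrite /desc; case: m => [|m] //=; rewrite eqxx. Qed.

Lemma desc0 a m : desc a m 0 = (m == 0%N).
Proof. by rewrite /desc /= orbF eq_sym. Qed.

Lemma desc_agree a b m v : agree v a b -> desc a m v = desc b m v.
Proof.
elim/ltn_ind: v => -[|v] IH ab; first by rewrite !desc0.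
rewrite !descS ab//; congr orb; apply: IH => // k kb.
by apply: ab; rewrite (ltn_trans kb)// ltnS.
Qed.

Lemma desc_lt a m v : (v < m)%N -> desc a m v = false.
Proof.
elim/ltn_ind: v => -[|v] IH vm; first by rewrite desc0 eq_sym ltn_eqF.
rewrite descS ltn_eqF//= IH//.
by rewrite (leq_ltn_trans _ vm)// ltnW// ltn_ord.
Qed.

(* A set of vertices which from the [m]-th tree on inherits its new vertices
   from their parents, and whose old part the later history does not affect. *)
Definition hereditary m (s : growth -> pred nat) :=
  (forall a b v, agree v a b -> s a v = s b v) /\
  (forall a k, (m <= k)%N -> s a k.+1 = s a (a k)).

Lemma hereditary_desc m : hereditary m (fun a => desc a m).
Proof.
split=> [a b v|a k mk]; first exact: desc_agree.
by rewrite descS gtn_eqF.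
Qed.

Lemma hereditaryC m s : hereditary m s -> hereditary m (fun a v => ~~ s a v).
Proof. by move=> [sl sS]; split=> [a b v /sl->|a k /sS->]. Qed.

Lemma hereditaryT m : hereditary m (fun=> predT).
Proof. by []. Qed.

(** The new vertex brings [phi 0] and raises the degree of its parent [i] by one; by heredity, both
    effects fall inside the set exactly when [i] does. *)
Lemma mass_upd (R : realType) (phi : nat -> R) m s a n (i : 'I_n.+1) :
  hereditary m s -> (m <= n)%N ->
  mass phi (s (upd a i)) (upd a i) n.+1 = mass phi (s a) a n +
    (s a i)%:R * (phi (deg a n i).+1 - phi (deg a n i) + phi 0%N).
Proof.
move=> [sl sS] mn.
have sE v : (v <= n)%N -> s (upd a i) v = s a v.
  by move=> vn; apply: sl => k kv; rewrite upd_agree// (leq_trans kv).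
rewrite /mass big_mkcond big_ord_recr/= deg_gt// sS// upd_at.
rewrite sE ?leq_ord//= [in RHS]big_mkcond /=.
have -> : \sum_(v < n.+1)
      (if s (upd a i) v then phi (deg (upd a i) n.+1 v) else 0) =
    \sum_(v < n.+1) ((if s a v then phi (deg a n v) else 0) +
      (if v == i then (s a i)%:R * (phi (deg a n i).+1 - phi (deg a n i))
       else 0)).
  apply: eq_bigr => v _; rewrite sE ?leq_ord// deg_upd eq_sym.
  rewrite -[_ == _ :> nat]/(v == i); case: eqP => [->|_].
    by case: (s a i); rewrite ?mul0r ?addr0// mul1r addn1 addrC subrK.
  by rewrite addn0 addr0.
rewrite big_split/= -!big_mkcond/= big_pred1_eq.
by case: (s a i); rewrite ?mul1r ?mul0r ?addr0// !addrA.
Qed.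

Lemma mass_desc_birth (R : realType) (phi : nat -> R) m a :
  mass phi (desc a m) a m = phi 0%N.
Proof.
rewrite /mass (bigD1 ord_max)/= ?desc_refl// deg_gt// big1 ?addr0// => v.
move=> /andP[dv]; rewrite -val_eqE /= => vm.
by move: dv; rewrite desc_lt// ltn_neqAle vm leq_ord.
Qed.

Lemma sum_deg (s : pred nat) a n :
  (\sum_(v < n.+1 | s v) deg a n v = \sum_(k < n) s (a k))%N.
Proof.
rewrite exchange_big/=; apply: eq_bigr => k _.
have ak : (a k < n.+1)%N.
  by rewrite (leq_trans (ltn_ord (a k)))// ltnS ltnW.
have E v : v != Ordinal ak -> (a k == v :> nat) = false.
  by apply: contraNF => /eqP av; apply/eqP/val_inj.
case: (boolP (s (a k))) => sa.
  by rewrite (bigD1 (Ordinal ak))//= eqxx big1// => v /andP[_ /E->].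
apply: big1 => v sv; rewrite E//; apply: contraNneq sa => vE.
by move: sv; rewrite vE.
Qed.

(** Each edge from a parent in [s] leads to a child in [s], save perhaps the edge to [m]; the root,
    which is in [s] but is no one's child, makes up for that one. *)
Lemma sum_deg_le (s : pred nat) (a : growth) n m : s 0%N ->
  (forall k, (s (a k) <= s k.+1 + (k.+1 == m))%N) ->
  (\sum_(v < n.+1 | s v) deg a n v <= \sum_(v < n.+1 | s v) 1)%N.
Proof.
move=> s0 sS; rewrite sum_deg [leqRHS]big_mkcond big_ord_recl /= s0.
apply: (@leq_trans (\sum_(k < n) (s k.+1 + (k.+1 == m)))%N).
  by apply: leq_sum => k _; exact: sS.
rewrite big_split/= addnC leq_add//.
elim: n => [|n IHn]; first by rewrite big_ord0.
rewrite big_ord_recr/=; have [<-|] := eqVneq; last by rewrite addn0.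
by rewrite big1// => k _; apply/eqP; rewrite eqb0 eqSS ltn_eqF.
Qed.

Lemma mass_le (R : realType) (phi : nat -> R) C (s : pred nat) (a : growth)
    n m :
  0 <= C -> (forall k, phi k <= C * k.+1%:R) -> s 0%N ->
  (forall k, (s (a k) <= s k.+1 + (k.+1 == m))%N) ->
  mass phi s a n <= 2 * C * \sum_(v < n.+1 | s v) 1.
Proof.
move=> C0 phi_le s0 sS.
apply: (@le_trans _ _ (C * (\sum_(v < n.+1 | s v) (deg a n v).+1)%N%:R)).
  by rewrite natr_sum mulr_sumr ler_sum.
have -> : \sum_(v < n.+1 | s v) 1 = (\sum_(v < n.+1 | s v) 1)%N%:R :> R.
  by rewrite natr_sum.
rewrite mulrAC [leRHS]mulrC ler_wpM2l// -natrM ler_nat.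
under eq_bigr do rewrite -addn1.
by rewrite big_split/= mul2n -addnn leq_add2r (sum_deg_le _ s0 sS).
Qed.

(** * Centrality of the root *)

Section Centrality.
Variables (a : growth) (n : nat).
Local Notation e := (adj a n).

Lemma childP (i j : 'I_n.+1) : reflect
  (exists2 k : nat, (j : nat) = k.+1 & (a k : nat) = i) (child a i j).
Proof.
rewrite /child; case E : (val j) => [|k].
  by constructor=> -[k jk]; move: E; rewrite /= jk.
apply: (iffP eqP) => [ak|[k' jk']]; first by exists k.
by have -> : k = k' by apply: succn_inj; exact: etrans (esym E) jk'.
Qed.

Lemma child_desc (i j : 'I_n.+1) z :
  child a i j -> desc a z j = (j == z :> nat) || desc a z i.
Proof. by move=> /childP[k -> <-]; rewrite descS. Qed.

(** A simple path from the root never goes up: the parent of its current end is an ancestor of that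
    end, hence is already on the path. *)
Lemma mem_path_root (p : seq 'I_n.+1) : path e ord0 p -> uniq (ord0 :: p) ->
  forall z : 'I_n.+1, (z \in ord0 :: p) = desc a z (last ord0 p).
Proof.
elim/last_ind: p => [|p w IHp]; first by move=> _ _ z; rewrite inE desc0.
rewrite rcons_path -rcons_cons rcons_uniq last_rcons.
move=> /andP[pp ew] /andP[wp up].
have IH := IHp pp up => z.
have [cw|cw] := orP ew.
  by rewrite mem_rcons inE IH (child_desc _ cw) eq_sym.
by move: wp; rewrite IH (child_desc _ cw) desc_refl orbT.
Qed.

Lemma card_subtree_root (c : 'I_n.+1) :
  (#|subtree e ord0 c| <= #|[set v : 'I_n.+1 | desc a c v]%SET|)%N.
Proof.
apply: subset_leq_card; apply/fintype.subsetP => v.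
rewrite /subtree !inE => -[p [pp up <- cp]].
by rewrite -mem_path_root.
Qed.

(** All non-descendants of [m] are connected to [i], through the root, by paths which avoid [m];
    putting [m] in front gives a simple path from [m] through [i]. *)
Lemma card_subtree_parent (i m : 'I_n.+1) : child a i m ->
  (#|[set v : 'I_n.+1 | ~~ desc a m v]%SET| <= #|subtree e m i|)%N.
Proof.
move=> im; apply: subset_leq_card; apply/fintype.subsetP => w.
rewrite /subtree !inE => mw.
pose e' := [rel x y : 'I_n.+1 | [&& e x y, ~~ desc a m x & ~~ desc a m y]].
have e'_sym : connect_sym e'.
  by apply: sym_connect_sym => x y /=; rewrite /adj orbC [X in _ && X]andbC.
have root_e' (x : 'I_n.+1) : ~~ desc a m x -> connect e' ord0 x.
  have [k] := ubnP (nat_of_ord x); elim: k x => // k IHk x xk mx.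
  case: (posnP x) => [x0|].
    by rewrite (_ : x = ord0) ?connect0//; exact: val_inj.
  case E : (nat_of_ord x) => [|j] // _.
  have aj : (a j < n.+1)%N.
    rewrite (leq_trans (ltn_ord (a j)))// -E; exact: ltnW.
  have ajx : (a j < x)%N by rewrite E; exact: ltn_ord.
  have cx : child a (Ordinal aj) x by apply/childP; exists j.
  have my : ~~ desc a m (Ordinal aj).
    by apply: contraNN mx => my; rewrite (child_desc _ cx) my orbT.
  apply: (connect_trans (IHk _ _ my)).
    exact: leq_trans ajx xk.
  by apply: connect1; rewrite /= mx my /adj cx.
have mi : ~~ desc a m i.
  have [k mk <-] := childP _ _ im.
  by rewrite desc_lt// mk ltn_ord.
have /connectP[p pp wE] : connect e' i w.
  by apply: connect_trans (root_e' _ mw); rewrite e'_sym root_e'.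
move: wE; case: (shortenP pp) => q qq uq _ wE.
have mq : m \notin i :: q.
  rewrite inE negb_or; apply/andP; split.
    by apply: contraNneq mi => <-; rewrite desc_refl.
  have path_all x r : path e' x r -> all (fun y : 'I_n.+1 => ~~ desc a m y) r.
    by elim: r x => //= y r IHr x /andP[/and3P[_ _ ->] /IHr].
  by apply/negP => /(allP (path_all _ _ qq)); rewrite desc_refl.
exists (i :: q); split; rewrite ?wE//.
- rewrite /= {1}/adj im orbT /=; apply: sub_path qq => x y.
  by case/andP.
- by rewrite cons_uniq mq.
- by rewrite !inE eqxx orbT.
Qed.

(** Let [T_x] be the set of descendants of [x], with [x] included, and let [c] attain [psi 0]. Then
    [n + 1 - |T_m| <= psi m <= psi 0 <= |T_c|], the first bound coming from the parent of [m].
    Taking complements exchanges [m] and [c]. *)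
Lemma psi_root_le (m : 'I_n.+1) : m != ord0 ->
  (psi e m <= psi e ord0)%N -> exists2 c : 'I_n.+1, c != ord0 &
  (#|[set v : 'I_n.+1 | ~~ desc a c v]%SET| <=
   #|[set v : 'I_n.+1 | desc a m v]%SET|)%N.
Proof.
move=> m0 psi_le.
have [|c c0 psi0] := @eq_bigmax_cond _ [pred v | v != ord0]
    (fun v => #|subtree e ord0 v|).
  by apply/card_gt0P; exists m.
exists c => //.
have [k mk] : exists k, m = k.+1 :> nat.
  by move: m0; rewrite -val_eqE /=; case: (nat_of_ord m) => // k; exists k.
have ak : (a k < n.+1)%N.
  by rewrite (leq_trans (ltn_ord (a k)))// -mk ltnW.
have cm : child a (Ordinal ak) m by apply/childP; exists k.
have : (#|[set v : 'I_n.+1 | ~~ desc a m v]%SET| <=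
        #|[set v : 'I_n.+1 | desc a c v]%SET|)%N.
  apply: leq_trans (card_subtree_parent cm) _.
  apply: leq_trans (card_subtree_root c).
  rewrite -[leqRHS]psi0; apply: leq_trans psi_le.
  apply: (@leq_bigmax_cond _ [pred v | v != m] (fun v => #|subtree e m v|)).
  by rewrite /= -val_eqE /= mk ltn_eqF.
have C x : (#|[set v : 'I_n.+1 | desc a x v]%SET| +
    #|[set v : 'I_n.+1 | ~~ desc a x v]%SET| = n.+1)%N.
  rewrite -[RHS]card_ord -(cardsC [set v : 'I_n.+1 | desc a x v]%SET).
  by congr addn; apply: eq_card => v; rewrite !inE.
by have := C m; have := C c; lia.
Qed.

(** Pigeonhole: [K] vertices other than the root cannot all lie among [1, ..., K - 1]. *)
Lemma least_values_root K (A : {set 'I_n.+1}) : (0 < K)%N ->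
  least_values (psi e) K A -> ord0 \notin A ->
  exists m c : 'I_n.+1, [/\ (K <= m)%N, c != ord0 &
  (#|[set v : 'I_n.+1 | ~~ desc a c v]%SET| <=
   #|[set v : 'I_n.+1 | desc a m v]%SET|)%N].
Proof.
move=> K0 [AK leA] A0.
have [m mA Km] : exists2 m, m \in A & (K <= m)%N.
  have [/exists_inP//|] := boolP [exists (m | m \in A), (K <= m)%N].
  rewrite negb_exists_in => /forall_inP lt_K.
  have : (#|A| <= K.-1)%N.
    rewrite cardE -(size_map val) -[K.-1](size_iota 1).
    apply: uniq_leq_size.
      by rewrite map_inj_uniq ?enum_uniq//; exact: val_inj.
    move=> x /mapP[u]; rewrite mem_enum => uA ->.
    rewrite mem_iota add1n prednK//= [(u < K)%N]ltnNge lt_K// andbT lt0n.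
    apply: contraNneq A0 => u0; rewrite (_ : ord0 = u)//.
    exact/val_inj.
  by rewrite AK -ltnS prednK// ltnn.
have m0 : m != ord0 by apply: contraNneq A0 => <-.
have [c c0 h] := psi_root_le m0 (leA _ _ mA A0).
by exists m, c.
Qed.

End Centrality.

(** * Moments of the shares *)

Section Weights.
Variables (R : realType) (f g : nat -> R) (l c C : R).
Hypothesis f_ge1 : forall k, 1 <= f k.
Hypothesis f_le : forall k, f k <= k.+1%:R.
Hypotheses (l_gt0 : 0 < l) (c_gt0 : 0 < c) (C_gt0 : 0 < C).
Hypothesis g0 : g 0%N = 1.
Hypothesis g_eigen : forall k, f k * (g k.+1 - g k + 1) = l * g k.
Hypothesis g_ge : forall k, c <= g k.
Hypothesis g_le : forall k, g k <= C * f k.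

(** [h k] is the gain in total weight when a vertex with [k] children gets another one, the new leaf
    counting for [g 0 = 1]. [B] bounds these gains, and [D / (n + 1) ^ 2] the error terms of
    [mean_ratio] and [mean_ratio2]. *)
Let B := l * C.
Let D := 3 * B ^+ 2 / c ^+ 2 + B * l / c.
Let h k := g k.+1 - g k + 1.

Let f_gt0 k : 0 < f k. Proof. exact: lt_le_trans (f_ge1 k). Qed.
Let g_gt0 k : 0 < g k. Proof. exact: lt_le_trans (g_ge k). Qed.

Let hE k : h k = l * g k / f k.
Proof. by rewrite -g_eigen mulrC mulKf// gt_eqF. Qed.

Let h_ge0 k : 0 <= h k.
Proof. by rewrite hE divr_ge0 ?mulr_ge0 ?ltW. Qed.

Let h_le k : h k <= B.
Proof. by rewrite hE ler_pdivrMr// /B -mulrA ler_pM2l. Qed.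

Let B_gt0 : 0 < B. Proof. exact: mulr_gt0. Qed.
Let B_ge0 : 0 <= B. Proof. exact: ltW. Qed.
Let c_ge0 : 0 <= c. Proof. exact: ltW. Qed.
Let l_ge0 : 0 <= l. Proof. exact: ltW. Qed.
Let C_ge0 : 0 <= C. Proof. exact: ltW. Qed.
Let D_ge0 : 0 <= D.
Proof. by rewrite /D addr_ge0// divr_ge0 ?mulr_ge0 ?exprn_ge0. Qed.

Definition ratio (s : growth -> pred nat) n a :=
  mass g (s a) a n / mass g predT a n.

Let mass_ge0 (s : pred nat) a n : 0 <= mass g s a n.
Proof. by apply: sumr_ge0 => v _; exact: ltW. Qed.

Let massT_ge a n : c * n.+1%:R <= mass g predT a n.
Proof. exact: mass_predT_ge. Qed.

Let massT_gt0 a n : 0 < mass g predT a n.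
Proof. by apply: lt_le_trans (massT_ge a n); rewrite mulr_gt0. Qed.

Lemma massC (s : pred nat) a n :
  mass g predT a n = mass g s a n + mass g (predC s) a n.
Proof. exact: bigID. Qed.

Lemma ratio_ge0 s n a : 0 <= ratio s n a.
Proof. by rewrite divr_ge0 ?mass_ge0. Qed.

Let massS m s a n (i : 'I_n.+1) : hereditary m s -> (m <= n)%N ->
  mass g (s (upd a i)) (upd a i) n.+1 =
  mass g (s a) a n + (s a i)%:R * h (deg a n i).
Proof. by move=> hs mn; rewrite (mass_upd _ _ _ hs mn) g0. Qed.

Let massTS a n (i : 'I_n.+1) :
  mass g predT (upd a i) n.+1 = mass g predT a n + h (deg a n i).
Proof. by rewrite (massS _ _ (@hereditaryT 0))// mul1r. Qed.

(** Here the equation for [g] enters: the attraction in the jump probability cancels the denominator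
    of [h], and the mean gain is proportional to the weight with a factor independent of [s]. *)
Let mean_jump (s : pred nat) a n :
  \sum_(i < n.+1) jump f a i * ((s i)%:R * h (deg a n i)) =
  l / mass f predT a n * mass g s a n.
Proof.
rewrite /mass [X in _ * X]big_mkcond mulr_sumr; apply: eq_bigr => i _.
rewrite hE /jump -/(mass f predT a n).
have W0 := lt0r_neq0 (mass_gt0 f_ge1 a n).
have fk := lt0r_neq0 (f_gt0 (deg a n i)).
by case: (s i); rewrite ?mul0r ?mulr0// mul1r; field; apply/andP.
Qed.

Let mean_jumpT a n : \sum_(i < n.+1) jump f a i * h (deg a n i) =
  l / mass f predT a n * mass g predT a n.
Proof.
by rewrite -mean_jump; apply: eq_bigr => i _; rewrite mul1r.
Qed.

Let sh_ge0 (s : pred nat) (i k : nat) : 0 <= (s i)%:R * h k.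
Proof. by rewrite mulr_ge0. Qed.

Let sh_le (s : pred nat) (i k : nat) : (s i)%:R * h k <= B.
Proof. by case: (s i); rewrite ?mul1r// mul0r ltW. Qed.

Let B2_le n a : 3 * B ^+ 2 / mass g predT a n ^+ 2 <= D / n.+1%:R ^+ 2.
Proof.
have n0 : 0 < n.+1%:R :> R by rewrite ltr0n.
apply: (@le_trans _ _ (3 * B ^+ 2 / (c * n.+1%:R) ^+ 2)).
  rewrite ler_wpM2l ?mulr_ge0 ?exprn_ge0//.
  rewrite lef_pV2 ?posrE ?exprn_gt0 ?mulr_gt0//.
  by rewrite lerXn2r ?nnegrE ?mulr_ge0.
rewrite [(c * _) ^+ 2]exprMn invfM mulrA ler_wpM2r ?invr_ge0 ?exprn_ge0// lerDl.
by rewrite divr_ge0 ?mulr_ge0.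
Qed.

Lemma ratio_step m s n a : hereditary m s -> (m <= n)%N ->
  step f n (ratio s n.+1) a <= ratio s n a * (1 + D / n.+1%:R ^+ 2).
Proof.
move=> hs mn; rewrite /step /ratio.
under eq_bigr do rewrite (massS _ _ hs mn) massTS.
apply: le_trans (mean_ratio (@jump_ge0 _ _ f_ge1 a n)
  (sum_jump f_ge1 a n) (mean_jump _ _ _) (mean_jumpT _ _)
  _ (fun=> h_ge0 _) (fun=> h_le _) _ (massT_gt0 _ _)) _ => //.
rewrite ler_wpM2l ?divr_ge0 ?mass_ge0// lerD2l (le_trans _ (B2_le n a))//.
by rewrite ler_wpM2r ?invr_ge0 ?exprn_ge0// ler_peMl ?exprn_ge0// ler1n.
Qed.

Lemma ratio2_step m s n a : hereditary m s -> (m <= n)%N ->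
  step f n (fun b => ratio s n.+1 b ^+ 2) a <=
  ratio s n a ^+ 2 * (1 + D / n.+1%:R ^+ 2) + D / n.+1%:R ^+ 2 * ratio s n a.
Proof.
move=> hs mn; rewrite /step /ratio.
under eq_bigr do rewrite (massS _ _ hs mn) massTS.
apply: le_trans (mean_ratio2 (@jump_ge0 _ _ f_ge1 a n)
  (sum_jump f_ge1 a n) (mean_jump _ _ _) (mean_jumpT _ _)
  _ _ (fun=> h_ge0 _) (fun=> h_le _) _ (massT_gt0 _ _)) _ => //.
apply: lerD.
  by rewrite ler_wpM2l ?exprn_ge0 ?divr_ge0// lerD2l B2_le.
(* The total attraction is at least [n + 1] and the total weight at least [c * (n + 1)]. *)
have -> : B * (l / mass f predT a n) * mass g (s a) a n /
    mass g predT a n ^+ 2 =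
    B * l / (mass f predT a n * mass g predT a n) *
      (mass g (s a) a n / mass g predT a n).
  have := lt0r_neq0 (mass_gt0 f_ge1 a n); have := lt0r_neq0 (massT_gt0 a n).
  by move=> ? ?; field; apply/andP.
rewrite ler_wpM2r ?divr_ge0//.
apply: (@le_trans _ _ (B * l / (n.+1%:R * (c * n.+1%:R)))).
  have fT := mass_gt0 f_ge1 a n.
  rewrite ler_wpM2l ?mulr_ge0// lef_pV2 ?posrE; last 2 first.
  - exact: mulr_gt0.
  - by rewrite !mulr_gt0.
  apply: ler_pM; rewrite ?mulr_ge0//.
  by rewrite -[leLHS]mul1r mass_predT_ge.
rewrite mulrCA invfM mulrA -expr2 ler_wpM2r ?invr_ge0 ?exprn_ge0//.
by rewrite lerDr divr_ge0 ?mulr_ge0 ?exprn_ge0.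
Qed.

(* The correction terms compensate the [D / n.+1%:R ^+ 2] of [ratio_step] and
   [ratio2_step], and make this a supermartingale. *)
Let potential s n a :=
  expR (2 * D / n.+1%:R) * (ratio s n a ^+ 2 + 2 * D / n.+1%:R * ratio s n a).

Let potential_step m s n a : hereditary m s -> (m <= n)%N ->
  step f n (potential s n.+1) a <= potential s n a.
Proof.
move=> hs mn; have r1 := ratio_step a hs mn; have r2 := ratio2_step a hs mn.
have -> : step f n (potential s n.+1) a = expR (2 * D / n.+2%:R) *
    (step f n (fun b => ratio s n.+1 b ^+ 2) a +
     2 * D / n.+2%:R * step f n (ratio s n.+1) a).
  rewrite /step [X in _ + X]mulr_sumr -big_split mulr_sumr.
  by apply: eq_bigr => i _ /=; rewrite /potential; ring.
rewrite /potential; have := ratio_ge0 s n a.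
move: (step _ _ _ _) (step _ _ _ _) (ratio s n a) r1 r2 => E1 E2 r r1 r2 r0.
have -> : n.+2%:R = n.+1%:R + 1 :> R by rewrite natr1.
have : 1 <= n.+1%:R :> R by rewrite ler1n.
move: (n.+1%:R) r1 r2 => N r1 r2 N1.
have N0 : 0 < N by lra.
(* From [N] to [N + 1] the correction releases [2 * D / (N * (N + 1))], at least [D / N ^ 2] as
   [N >= 1]. This serves twice, in the exponent and in the linear term. *)
have DN : 2 * D / (N + 1) + D / N ^+ 2 <= 2 * D / N.
  rewrite -subr_ge0.
  have -> : 2 * D / N - (2 * D / (N + 1) + D / N ^+ 2) =
      D * (N - 1) / (N ^+ 2 * (N + 1)).
    by field; apply/andP; split; lra.
  by rewrite divr_ge0 ?mulr_ge0 ?exprn_ge0//; lra.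
set p := D / N ^+ 2 in r1 r2 DN; set q := 2 * D / (N + 1) in DN *.
set q' := 2 * D / N in DN *.
have p0 : 0 <= p by rewrite divr_ge0 ?exprn_ge0 ?(ltW N0).
have q0 : 0 <= q by rewrite divr_ge0 ?mulr_ge0//; lra.
have q'0 : 0 <= q' by rewrite (le_trans _ DN)// addr_ge0.
clearbody p q q'.
have e_le : expR q * (1 + p) <= expR q'.
  apply: (@le_trans _ _ (expR (q + p))); last by rewrite ler_expR.
  by rewrite expRD ler_wpM2l ?expR_ge0 ?expR_ge1Dx.
apply: (@le_trans _ _ (expR q * ((1 + p) * (r ^+ 2 + q' * r)))); last first.
  by rewrite mulrA ler_wpM2r// addr_ge0 ?mulr_ge0 ?exprn_ge0.
rewrite ler_wpM2l ?expR_ge0//.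
have h1 := ler_wpM2l q0 r1; apply: le_trans (lerD r2 h1) _.
have h2 : (1 + p) * (r * (q + p)) <= (1 + p) * (r * q').
  by rewrite !ler_wpM2l//; lra.
have h3 : 0 <= p * p * r by rewrite !mulr_ge0.
by nra.
Qed.

(** At the birth of [m] its share is at most [1 / (c * (m + 1))], so that the potential is at most
    this constant over [(m + 1) ^ 2]. *)
Definition moment2 := expR (2 * D) * (c^-1 ^+ 2 + 2 * D / c).

Lemma moment2_ge0 : 0 <= moment2.
Proof.
rewrite mulr_ge0 ?expR_ge0// addr_ge0 ?exprn_ge0 ?divr_ge0 ?mulr_ge0//.
by rewrite invr_ge0.
Qed.

Let steps_from (F : nat -> growth -> R) m n K a :
  (forall b, F m b <= K) -> (m <= n)%N ->
  (forall k b, (m <= k)%N -> step f k (F k.+1) b <= F k b) ->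
  steps f 0 n (F n) a <= K.
Proof.
move=> F_le mn hF; rewrite -(subnKC mn) steps_add add0n.
rewrite -[leRHS](steps_cst f_ge1 0 m K a); apply: steps_le => // b.
by apply: le_trans (F_le b); exact: steps_supermartingale.
Qed.

Lemma ratio_desc_moment2 m n a : (m <= n)%N ->
  steps f 0 n (fun b => ratio (fun a => desc a m) n b ^+ 2) a <=
  moment2 / m.+1%:R ^+ 2.
Proof.
move=> mn; set s := fun a => desc a m.
apply: (@le_trans _ _ (steps f 0 n (potential s n) a)).
  apply: steps_le => // b; rewrite -[leLHS]mul1r ler_pM ?exprn_ge0 ?ratio_ge0//.
    by rewrite -expR0 ler_expR divr_ge0 ?mulr_ge0.
  by rewrite lerDl !mulr_ge0 ?ratio_ge0 ?invr_ge0.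
apply: (@steps_from (potential s) m) => //; last first.
  by move=> k b mk; apply: potential_step mk; exact: hereditary_desc.
move=> b; have m0 : 1 <= m.+1%:R :> R by rewrite ler1n.
have r_le : ratio s m b <= c^-1 / m.+1%:R.
  rewrite /ratio /s mass_desc_birth g0 mul1r -invfM.
  by rewrite lef_pV2 ?massT_ge// posrE ?mulr_gt0 ?ltr0n ?massT_gt0.
have r0 := ratio_ge0 s m b.
rewrite /moment2 /potential -[leRHS]mulrA [(_ + 2 * D / c) * _]mulrDl.
apply: ler_pM.
- exact: expR_ge0.
- by rewrite addr_ge0 ?exprn_ge0 ?mulr_ge0 ?invr_ge0.
- by rewrite ler_expR ler_pdivrMr ?ltr0n// ler_peMr ?mulr_ge0.
rewrite lerD//.
  by rewrite -exprVn -exprMn lerXn2r ?nnegrE// mulr_ge0 ?invr_ge0 ?ltW.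
apply: (@le_trans _ _ (2 * D / m.+1%:R * (c^-1 / m.+1%:R))).
  by rewrite ler_wpM2l// divr_ge0 ?mulr_ge0.
apply: eqW; have := lt0r_neq0 c_gt0; have := lt0r_neq0 (lt_le_trans ltr01 m0).
by move=> ? ?; field; apply/andP.
Qed.

(* The last term makes this a supermartingale: it absorbs the concavity defect
   of the logarithm. *)
Definition log_ratio (s : growth -> pred nat) n a :=
  ln (mass g predT a n) - ln (mass g (s a) a n) + B / mass g (s a) a n.

Let mass_ge_c (s : pred nat) a n : s 0%N -> c <= mass g s a n.
Proof.
move=> s0; rewrite /mass (bigD1 ord0)//=.
by rewrite (le_trans (g_ge (deg a n 0)))// lerDl sumr_ge0// => i _; exact: ltW.
Qed.

Lemma log_ratio_step m s n a : hereditary m s -> s a 0%N -> (m <= n)%N ->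
  step f n (log_ratio s n.+1) a <= log_ratio s n a.
Proof.
move=> hs s0 mn; rewrite /step /log_ratio.
under eq_bigr do rewrite (massS _ _ hs mn) massTS.
apply: (mean_log_ratio (@jump_ge0 _ _ f_ge1 a n)
  (sum_jump f_ge1 a n) (mean_jump _ _ _) (mean_jumpT _ _)
  _ _ (fun=> h_ge0 _) (massT_gt0 _ _)) => //.
exact: lt_le_trans (mass_ge_c _ _ s0).
Qed.

Lemma massT_le a n : mass g predT a n <= 2 * C * n.+1%:R.
Proof.
apply: le_trans (@mass_le _ _ C predT a n 0 (ltW C_gt0) _ _ _) _ => //.
  by move=> k; rewrite (le_trans (g_le k))// ler_pM2l.
by rewrite sumr_const (_ : #|_| = n.+1)// -[RHS]card_ord.
Qed.

(** At the birth of [m], the complement of its subtree contains the root, hence weighs at least [c].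
    This bound grows with [m]: it serves for finitely many vertices only. *)
Definition log_moment m := ln (2 * C * m.+1%:R) - ln c + B / c.

Lemma log_ratio_moment m n a : (0 < m)%N -> (m <= n)%N ->
  steps f 0 n (log_ratio (fun a v => ~~ desc a m v) n) a <= log_moment m.
Proof.
move=> m0 mn; set s := fun a v => ~~ desc a m v.
have s0 b : s b 0%N by rewrite /s desc0 gtn_eqF.
apply: (@steps_from (log_ratio s) m) => //; last first.
  move=> k b mk; apply: log_ratio_step (mk) => //.
  exact/hereditaryC/hereditary_desc.
move=> b; have cs := mass_ge_c b m (s0 b).
have Vs := lt_le_trans c_gt0 cs.
rewrite lerD// ?lerB// ?ler_ln ?posrE ?massT_le ?mulr_gt0//.
by rewrite ler_wpM2l ?(ltW B_gt0)// lef_pV2 ?posrE.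
Qed.

Lemma log_ratio_ge (s : growth -> pred nat) n a : s a 0%N ->
  mass g predT a n <= mass g (s a) a n * expR (log_ratio s n a).
Proof.
move=> s0; have Vs := lt_le_trans c_gt0 (mass_ge_c a n s0).
rewrite -[X in X * _]lnK ?posrE// -expRD -[leLHS]lnK ?posrE// ler_expR.
have : 0 <= B / mass g (s a) a n by rewrite divr_ge0 ?mass_ge0.
by rewrite /log_ratio; lra.
Qed.

Lemma log_ratio_ge0 (s : growth -> pred nat) n a :
  s a 0%N -> 0 <= log_ratio s n a.
Proof.
move=> s0; have Vs := lt_le_trans c_gt0 (mass_ge_c a n s0).
rewrite addr_ge0 ?divr_ge0 ?(ltW B_gt0) ?(ltW Vs)// subr_ge0 ler_ln ?posrE//.
by rewrite (massC (s a)) lerDl.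
Qed.

(** * Rivals of the root are unlikely *)

Lemma sum_inv_sqr_le K n : (0 < K)%N ->
  \sum_(i < n | (K <= i)%N) i.+1%:R ^- 2 <= K%:R^-1 :> R.
Proof.
move=> K0; rewrite -(big_geq_mkord _ _ predT (fun i => i.+1%:R ^- 2)).
have [nK|/ltnW Kn] := leqP n K; first by rewrite big_geq.
apply: (@le_trans _ _ (\sum_(K <= i < n) (- i.+1%:R^-1 - - i%:R^-1 : R))).
  rewrite big_nat_cond [leRHS]big_nat_cond; apply: ler_sum => i.
  rewrite andbT => /andP[Ki _]; have i0 : 0 < i%:R :> R.
    by rewrite ltr0n (leq_trans K0).
  rewrite -natr1; move: i%:R i0 => x x0.
  rewrite -subr_ge0; have -> : - (x + 1)^-1 - - x^-1 - (x + 1) ^- 2 =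
      (x * (x + 1) ^+ 2)^-1.
    by field; apply/andP; split; lra.
  by rewrite invr_ge0 mulr_ge0 ?exprn_ge0//; lra.
by rewrite telescope_sumr// opprK gerDr oppr_le0 invr_ge0.
Qed.

(* By [least_values_root], this happens whenever the root is not among the [K]
   least values of [psi]. *)
Definition rival K n (a : growth) := exists m k : 'I_n.+1,
  [/\ (K <= m)%N, k != ord0 &
    (#|[set v : 'I_n.+1 | ~~ desc a k v]%SET| <=
     #|[set v : 'I_n.+1 | desc a m v]%SET|)%N].

Lemma rival_agree K n a b : agree n a b -> rival K n a -> rival K n b.
Proof.
move=> ab [m [k [Km k0 le_mk]]]; exists m, k; split=> //.
have E (x v : 'I_n.+1) : desc b x v = desc a x v.
  by apply/esym/desc_agree => j jv; apply: ab; exact: leq_trans (leq_ord v).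
rewrite (eq_card (B := [set v : 'I_n.+1 | ~~ desc a k v]%SET)); last first.
  by move=> v; rewrite !inE E.
rewrite (eq_card (A := [set v : 'I_n.+1 | desc b m v]%SET)
  (B := [set v : 'I_n.+1 | desc a m v]%SET))//.
by move=> v; rewrite !inE E.
Qed.

(** A set of [N] vertices weighs at least [c * N], and the complement of the subtree below a vertex
    other than the root at most [2 * C * N]: this factor turns a comparison of sizes into one of
    shares. *)
Let kappa := c / (2 * C).

(* Markov's bound on the indicator function of [rival K n]: some vertex from
   [K] on has weight at least [kappa * expR (- t)], or some vertex from [K0] on
   has weight at least 1/2, or the vertices which do not descend from some
   vertex before [K0] have together weight at most [expR (- t)]. *)
Definition rival_bound K0 K t n a :=
  (kappa * expR (- t)) ^- 2 *
    \sum_(i < n.+1 | (K <= i)%N) ratio (fun a => desc a i) n a ^+ 2 +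
  4 * \sum_(i < n.+1 | (K0 <= i)%N) ratio (fun a => desc a i) n a ^+ 2 +
  t^-1 * \sum_(i < K0 | (0 < i)%N) log_ratio (fun a v => ~~ desc a i v) n a.

Lemma ler_sum_term (I : finType) (P : pred I) (F : I -> R) i :
  P i -> (forall j, P j -> 0 <= F j) -> F i <= \sum_(j | P j) F j.
Proof.
by move=> Pi F0; rewrite (bigD1 i)//= lerDl sumr_ge0// => j /andP[/F0].
Qed.

Let not_desc0 (a : growth) k : (0 < k)%N -> ~~ desc a k 0.
Proof. by move=> k0; rewrite desc0 gtn_eqF. Qed.

Lemma rival_bound_ge0 K0 K t n a : 0 <= t -> 0 <= rival_bound K0 K t n a.
Proof.
move=> t0; apply: addr_ge0; first apply: addr_ge0; apply: mulr_ge0;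
  rewrite ?invr_ge0 ?sqr_ge0// sumr_ge0// => i i0; rewrite ?sqr_ge0//.
exact/log_ratio_ge0/not_desc0.
Qed.

Lemma rival_bound_ge1 K0 K t n a : 1 <= t -> rival K n a ->
  1 <= rival_bound K0 K t n a.
Proof.
move=> t1 [m [k [Km k0 le_mk]]]; have t0 : 0 < t by apply: lt_le_trans t1.
have k_gt0 : (0 < k)%N by rewrite lt0n.
pose r i := ratio (fun a => desc a i) n a.
pose x := ratio (fun a v => ~~ desc a k v) n a.
have rx : r k + x = 1.
  by rewrite /r /x /ratio -mulrDl -massC divff// gt_eqF.
have sum1 (s : pred nat) :
    \sum_(v < n.+1 | s v) 1 = #|[set v : 'I_n.+1 | s v]%SET|%:R :> R.
  by rewrite sumr_const cardsE.
have kx : kappa * x <= r m.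
  rewrite /kappa /x /r /ratio mulrA ler_wpM2r ?invr_ge0//.
  rewrite mulrAC ler_pdivrMr ?mulr_gt0// mulrC.
  apply: (@le_trans _ _ (2 * C * (\sum_(v < n.+1 | ~~ desc a k v) 1) * c)).
    rewrite ler_wpM2r// (@mass_le _ _ C _ a n k)//.
    - by move=> j; rewrite (le_trans (g_le j))// ler_pM2l.
    - by rewrite not_desc0.
    - move=> j; rewrite descS; case: eqVneq => _; first by case: desc.
      by rewrite addn0.
  rewrite -mulrA [leRHS]mulrC ler_wpM2l ?mulr_ge0//.
  apply: le_trans (mass_ge (fun v => desc a m v) a n g_ge).
  rewrite mulrC ler_wpM2l// (sum1 (fun v => ~~ desc a k v)) sum1.
  by rewrite ler_nat.
pose S1 := \sum_(i < n.+1 | (K <= i)%N) r i ^+ 2.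
pose S2 := \sum_(i < n.+1 | (K0 <= i)%N) r i ^+ 2.
pose S3 := \sum_(i < K0 | (0 < i)%N) log_ratio (fun a v => ~~ desc a i v) n a.
have kt0 : 0 < kappa * expR (- t).
  by rewrite mulr_gt0 ?expR_gt0 ?divr_gt0 ?mulr_gt0.
have T1 : 0 <= (kappa * expR (- t)) ^- 2 * S1.
  by rewrite mulr_ge0 ?invr_ge0 ?sqr_ge0 ?sumr_ge0// => i _; exact: sqr_ge0.
have T2 : 0 <= 4 * S2.
  by rewrite mulr_ge0 ?sumr_ge0// => i _; exact: sqr_ge0.
have T3 : 0 <= t^-1 * S3.
  rewrite mulr_ge0 ?invr_ge0 ?(ltW t0)// sumr_ge0// => i i0.
  exact/log_ratio_ge0/not_desc0.
rewrite /rival_bound -/S1 -/S2 -/S3.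
(* If the complement keeps the share [expR (- t)], then [m >= K] has at least [kappa * expR (- t)],
   which the first sum detects. *)
have case_x : expR (- t) <= x -> 1 <= (kappa * expR (- t)) ^- 2 * S1.
  move=> tx; rewrite -ler_pdivrMl ?invr_gt0 ?exprn_gt0// mulr1 invrK.
  apply: le_trans (@ler_sum_term _ (fun i : 'I_n.+1 => (K <= i)%N)
    (fun i => r i ^+ 2) m Km (fun j _ => sqr_ge0 _)).
  rewrite lerXn2r ?nnegrE ?(ltW kt0) ?ratio_ge0//; apply: le_trans kx.
  by apply: ler_wpM2l => //; rewrite divr_ge0 ?mulr_ge0.
(* For an early [k], either [log_ratio] is at least [t] or the complement keeps its share. For a
   late [k], either its share is at least 1/2 or that of the complement is, and
   [1 / 2 >= expR (- t)] as [t >= 1]. *)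
have [kK0|K0k] := ltnP k K0.
  have [tl|lt] := leP t (log_ratio (fun a v => ~~ desc a k v) n a).
    suff : 1 <= t^-1 * S3 by lra.
    rewrite -ler_pdivrMl ?invr_gt0// mulr1 invrK (le_trans tl)//.
    apply: (@ler_sum_term _ (fun i : 'I_K0 => (0 < i)%N)
      (fun i => log_ratio (fun a v => ~~ desc a i v) n a) (Ordinal kK0)) => //.
    by move=> i i0; apply/log_ratio_ge0/not_desc0.
  suff : expR (- t) <= x by move=> /case_x; lra.
  rewrite expRN /x /ratio ler_pdivlMr// mulrC ler_pdivrMr ?expR_gt0//.
  apply: le_trans (@log_ratio_ge (fun a v => ~~ desc a k v) n a _) _.
    exact: not_desc0.
  by rewrite ler_wpM2l// ler_expR ltW.
have [rk|rk] := leP (1 / 2) (r k).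
  suff : 1 <= 4 * S2 by lra.
  have : r k ^+ 2 <= S2.
    exact: (@ler_sum_term _ (fun i : 'I_n.+1 => (K0 <= i)%N)
      (fun i => r i ^+ 2) k K0k (fun j _ => sqr_ge0 _)).
  by nra.
suff : expR (- t) <= x by move=> /case_x; lra.
apply: (@le_trans _ _ (1 / 2)); last by lra.
rewrite expRN div1r lef_pV2 ?posrE ?expR_gt0//.
by apply: le_trans (expR_ge1Dx t); lra.
Qed.

Lemma steps_rival_bound K0 K t n a : (0 < K0)%N -> (K0 <= K <= n)%N -> 0 < t ->
  steps f 0 n (rival_bound K0 K t n) a <=
  (kappa * expR (- t)) ^- 2 * (moment2 / K%:R) + 4 * (moment2 / K0%:R) +
  t^-1 * \sum_(i < K0 | (0 < i)%N) log_moment i.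
Proof.
move=> K0_gt0 /andP[K0K Kn] t0.
have S j : (0 < j)%N -> steps f 0 n (fun b =>
    \sum_(i < n.+1 | (j <= i)%N) ratio (fun a => desc a i) n b ^+ 2) a <=
    moment2 / j%:R.
  move=> j0; rewrite steps_sum//.
  apply: (@le_trans _ _ (moment2 * \sum_(i < n.+1 | (j <= i)%N) i.+1%:R ^- 2)).
    rewrite mulr_sumr; apply: ler_sum => i _.
    by rewrite ratio_desc_moment2// leq_ord.
  by rewrite ler_wpM2l ?moment2_ge0 ?sum_inv_sqr_le.
rewrite /rival_bound !stepsD !stepsZ; apply: lerD; first apply: lerD.
- rewrite ler_wpM2l ?S ?(leq_trans K0_gt0)//.
  by rewrite invr_ge0 sqr_ge0.
- by rewrite ler_wpM2l// S.
- rewrite ler_wpM2l ?invr_ge0 ?(ltW t0)//.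
  rewrite steps_sum//.
  apply: ler_sum => i i0; apply: log_ratio_moment => //.
  by rewrite (leq_trans _ Kn)// (leq_trans _ K0K)// ltnW.
Qed.

(** The order of choice matters: [K0] for the second term, then [t] for the third, whose sum depends
    on [K0], and at last [K] for the first, whose factor depends on [t]. Each term gets
    [eps / 3]. *)
Lemma rival_bound_small (eps : R) a : 0 < eps -> exists K0 K t,
  [/\ (0 < K)%N, 1 <= t & forall n, (K <= n)%N ->
    steps f 0 n (rival_bound K0 K t n) a <= eps].
Proof.
move=> eps0; pose x0 := 12 * moment2 / eps.
have m0 := moment2_ge0.
have x0_ge0 : 0 <= x0.
  exact: divr_ge0 (mulr_ge0 _ m0) (ltW eps0).
pose K0 := (Num.bound x0).+1.
pose L := \sum_(i < K0 | (0 < i)%N) log_moment i.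
pose t := 1 + `|3 * L / eps|.
have t0 : 0 < t by rewrite ltr_pwDl.
pose k2 := (kappa * expR (- t)) ^- 2.
have k2_ge0 : 0 <= k2 by rewrite /k2 invr_ge0 sqr_ge0.
pose x1 := 3 * (k2 * moment2) / eps.
have x1_ge0 : 0 <= x1.
  exact: divr_ge0 (mulr_ge0 _ (mulr_ge0 k2_ge0 m0)) (ltW eps0).
pose K := (K0 + Num.bound x1)%N.
exists K0, K, t; split=> //; first by rewrite lerDl.
move=> n Kn; apply: le_trans (steps_rival_bound _ _ _ t0) _ => //.
  by rewrite leq_addr.
have K0x : x0 < K0%:R.
  by rewrite (lt_le_trans (archi_boundP x0_ge0))// ler_nat.
have Kx : x1 < K%:R.
  by rewrite (lt_le_trans (archi_boundP x1_ge0))// ler_nat leq_addl.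
have h1 : k2 * (moment2 / K%:R) <= eps / 3.
  rewrite mulrA ler_pdivrMr ?ltr0n ?addn_gt0//.
  by move: Kx; rewrite /x1 ltr_pdivrMr//; lra.
have h2 : 4 * (moment2 / K0%:R) <= eps / 3.
  rewrite mulrA ler_pdivrMr ?ltr0n//.
  by move: K0x; rewrite /x0 ltr_pdivrMr//; lra.
have h3 : t^-1 * L <= eps / 3.
  rewrite ler_pdivrMl//; have := ler_norm (3 * L / eps).
  rewrite ler_pdivrMr//; move: t0; rewrite /t; lra.
by rewrite -/L -/k2; lra.
Qed.

End Weights.

(** * From the finite sums to the lower limit *)

Lemma outdegE (a : growth) n (i : 'I_n.+1) : outdeg a i = deg a n i.
Proof.
rewrite /outdeg -sum1_card big_mkcond big_ord_recl /= inE /child /= add0n.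
by apply: eq_bigr => k _; rewrite inE /=; case: eqP.
Qed.

Lemma limn_einf_ge (R : realType) (x : \bar R) (u : (\bar R)^nat) N :
  (forall n, (N <= n)%N -> (x <= u n)%E) -> (x <= limn_einf u)%E.
Proof.
move=> xu; rewrite limn_einf_lim; apply: lime_ge; first exact: is_cvg_einfs.
exists N => // n /= Nn; apply: le_ereal_inf_tmp => _ [k /= nk <-].
by apply: xu; exact: leq_trans nk.
Qed.

Theorem theorem4 (R : realType) (alpha : R) (halpha : 0 < alpha < 1)
    (d : measure_display) (T : measurableType d) (P : probability T R)
    (X : T -> growth) (hX : preferential_attachment alpha P X)
    (eps : R) (heps : 0 < eps) :
  exists K : nat,
    forall H : forall n : nat, T -> {set 'I_n.+1},
      (forall n w, (K <= n.+1)%N ->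
         least_values (psi (adj (X w) n)) K (H n w)) ->
      (forall n, measurable [set w | ord0 \in H n w]) ->
      ((1 - eps)%:E <= limn_einf (fun n => P [set w | ord0 \in H n w]))%E.
Proof.
have [a0 a1] := andP halpha.
set f := attraction alpha.
have f_ge1 k : 1 <= f k by exact/attraction_ge1/ltW.
have f_le k : f k <= k.+1%:R by exact/attraction_le/ltW.
have fS k : f k.+1 <= f k + alpha by exact: attractionS_le.
have [l [g [c [C [[l0 c0 C0] g0 g_eigen g_ge g_le]]]]] :=
  exists_eigenfunction (ltW a0) a1 f_ge1 f_le fS.
have [mX PX] := hX.
have PX' a n (i : 'I_n.+1) : P (past X a n `&` [set w | X w n = i]) =
    (P (past X a n) * (jump f a i)%:E)%E.
  rewrite PX /jump /mass outdegE; under eq_bigr do rewrite outdegE.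
  by [].
(* An arbitrary history to start from. *)
pose a : growth := fun=> ord0.
have [K0 [K [t [K_gt0 t1 bound_le]]]] :=
  rival_bound_small f_ge1 f_le l0 c0 C0 g0 g_eigen g_ge g_le a heps.
exists K => H leH mH; apply: (@limn_einf_ge _ _ _ K) => n Kn.
have t0 : 0 <= t by apply: le_trans t1.
have [mG PG] := prob_ge_steps f_ge1 mX PX' (G := [set b | ~ rival K n b]) a
  (fun b c bc nb rc => nb (rival_agree (fun k kn => esym (bc k kn)) rc))
  (fun b => rival_bound_ge0 l0 c0 C0 g_ge K0 K n b t0)
  (fun b nb => rival_bound_ge1 f_le l0 c0 C0 g_ge g_le K0 t1 (contrapT nb)).
apply: (@le_trans _ _ (P [set w | ~ rival K n (X w)])).
  by apply: le_trans PG; rewrite lee_fin lerD2l lerN2 bound_le.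
(* Without a rival, the root is selected however the ties are broken. *)
apply: le_measure; rewrite ?inE// => w /= nr; apply: contrapT => /negP Hw.
apply: nr; apply: least_values_root (leH n w _) Hw => //.
exact: leqW.
Qed.
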